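(* Let $E$ be a symmetric cosimplicial monoid in a symmetric tensor category $\mathbf V$ over a field of characteristic zero. Then: (1) the top component of the Hodge decomposition of the cohomology is the subspace of anti-symmetric poly-primitive elements: $H^{n,n}(E)=P^n(E)$ (that is, $P^n(E)$ consists of cocycles and taking cohomology classes identifies $P^n(E)$ with $H^{n,n}(E)$); (2) if $E$ is $k$-commutative for some $k\ge2$, then the top degree component $P^m(E)\otimes P^n(E)\to P^{m+n-k}(E)$ of the bracket $\beta^{(k)}$ is zero.
   Context: **Symmetric cosimplicial monoids.** $\Delta$ is the category of $[n]=\{0<\dots<n\}$ and nondecreasing maps. $\Gamma$ is the opposite of the category of finite pointed sets $[n]=\{0,\dots,n\}$ (base point $0$). There is a functor $\Delta\to\Gamma$: $\Delta$ is dual (Joyal duality) to the category of intervals $\langle n+1\rangle=\{0<\dots<n+1\}$ and end-point preserving monotone maps, and an interval map $\phi:\langle n\rangle\to\langle m\rangle$ is sent to the pointed map $[n-1]\to[m-1]$, $i\mapsto\phi(i)$ if $\phi(i)\ne m$ and $i\mapsto0$ otherwise. A symmetric cosimplicial monoid is a functor $E:\Gamma\to\mathbf{Mon}(\mathbf V)$; its underlying cosimplicial monoid is the restriction to $\Delta$, with cofaces $\partial_i:E(n)\to E(n+1)$, $0\le i\le n+1$. The symmetric group $S_n$ acts on $E(n)$ by monoid automorphisms; $t_i$ denotes the action of the transposition $(i,i+1)$. One has $t_n\cdots t_1\partial_0=\partial_{n+1}$ and $t_i\partial_i=\partial_i$. Elements are to be read as in modules over the field (or as generalised elements). $E$ has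 cochain complex $E(n)$ with $\partial=\sum_{i=0}^{n+1}(-1)^i\partial_i$ and cohomology $H^n(E)$. **Hodge decomposition.** The symmetric group actions give, via the Eulerian idempotents, $H^n(E)=H^{n,0}(E)\oplus\dots\oplus H^{n,n}(E)$; the top component $H^{n,n}(E)$ is the part cut out by the antisymmetriser $\mathrm{alt}_n=\frac1{n!}\sum_{\sigma\in S_n}\mathrm{sgn}(\sigma)\sigma$, i.e. the classes represented by anti-symmetric cocycles. An element $a\in E(n)$ is anti-symmetric if $t_i(a)=-a$ for $1\le i\le n-1$. **Poly-primitive elements.** For $a\in E(n)$ put $\hat a_i=t_i\cdots t_1\partial_0(a)\in E(n+1)$, $0\le i\le n$ (so $\hat a_0=\partial_0(a)$, $\hat a_n=\partial_{n+1}(a)$). $a$ is poly-primitive if $\partial_i(a)=\hat a_{i-1}+\hat a_i$ for $i=1,\dots,n$. $P^n(E)\subset E(n)$ is the subspace of anti-symmetric poly-primitive elements. **$k$-commutativity.** For nondecreasing $\tau:[p]\to[m]$, $\pi:[q]\to[m]$, $\mathbf{lk}(\tau,\pi)$ is the least $N$ such that there are decompositions into nonempty disjoint sets $Im(\tau)=A_1\cup\dots\cup A_s$, $A_1<\dots<A_s$, $Im(\pi)=B_1\cup\dots\cup B_t$, $B_1<\dots<B_t$, $s+t=N+1$, $|s-t|\le1$, with $A_1\le B_1\le A_2\le\cdots$ or $B_1\le A_1\le B_2\le\cdots$ ($A\le B$: each element of $A$ is $\le$ each element of $B$). $E$ is $k$-commutative if the images of $E(\tau)$ and $E(\pi)$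 commute whenever $\mathbf{lk}(\tau,\pi)\le k$. **The bracket $\beta^{(k)}$.** It is the degree $-k$ operation $E(p)\otimes E(q)\to E(p+q-k)$, $\beta^{(k)}(a\otimes b)=\sum_\psi\pm\psi(a\otimes b)$, a sum with signs $\pm1$ over all smooth lattice paths of complexity $k+1$, as follows. Put $r=p+q-k$. Such a $\psi$ is given by a word with $p+1$ letters $1$ and $q+1$ letters $2$ having exactly $k+1$ changes of letter and in which each maximal run of equal letters other than the first and the last has length at least $2$; following the word as a unit-step path from $(0,0)$ to $(p+1,q+1)$ and omitting the $k+1$ corners one gets points $(x(i),y(i))$, $0\le i\le r+1$. Define $f_1:[p]\to[r]$ by $f_1(j)=i$ iff $x(i)\le j<x(i+1)$ and $f_2:[q]\to[r]$ by $f_2(j)=i$ iff $y(i)\le j<y(i+1)$. Then $\psi(a\otimes b)=E(f_1)(a)E(f_2)(b)$ if the word begins with $1$ and $\psi(a\otimes b)=E(f_2)(b)E(f_1)(a)$ if it begins with $2$. With $\rho$ the number of pairs (letter $2$ before letter $1$) in the word, the sign is $(-1)^{(p-1)(q-1)+\rho}$ for words beginning with $1$, and $(-1)^{k+(p-1)(q-1)+\rho}$ for words beginning with $2$. The top degree component of $\beta^{(k)}$ is the restriction to $P^m(E)\otimes P^n(E)$ followed by $\mathrm{alt}_{m+n-k}$ (the projection to the top Hodge component). *)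

(* Defs.v *)
From HB Require Import structures.
From mathcomp Require Import all_boot all_order all_fingroup all_algebra.

Set Implicit Arguments.
Unset Strict Implicit.
Unset Printing Implicit Defensive.

Import GRing.Theory.
Local Open Scope ring_scope.

Reserved Notation "g <o> f" (at level 40, left associativity).
Reserved Notation "X <x> Y" (at level 39, left associativity).
Reserved Notation "f <xm> g" (at level 39, left associativity).

(** * Symmetric tensor categories over a field *)

Record linear_category (F : fieldType) := LinearCategory {
  ob :> Type;
  mor : ob -> ob -> lmodType F;
  idm : forall X, mor X X;
  ccomp : forall X Y Z, mor Y Z -> mor X Y -> mor X Z;
  ccomp_idl : forall X Y (f : mor X Y), ccomp (idm Y) f = f;
  ccomp_idr : forall X Y (f : mor X Y), ccomp f (idm X) = f;
  ccompA : forall W X Y Z (h : mor Y Z) (g : mor X Y) (f : mor W X),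
    ccomp h (ccomp g f) = ccomp (ccomp h g) f;
  ccomp_linearl : forall X Y Z (c : F) (g g' : mor Y Z) (f : mor X Y),
    ccomp (c *: g + g') f = c *: ccomp g f + ccomp g' f;
  ccomp_linearr : forall X Y Z (c : F) (g : mor Y Z) (f f' : mor X Y),
    ccomp g (c *: f + f') = c *: ccomp g f + ccomp g f'
}.

Arguments idm {F l} X.
Notation "g <o> f" := (ccomp g f) : ring_scope.

Section LinearCategory.
Variables (F : fieldType) (C : linear_category F).

Definition is_iso (X Y : C) (f : mor X Y) : Prop :=
  exists g : mor Y X, g <o> f = idm X /\ f <o> g = idm Y.

Definition is_kernel (K X Y : C) (f : mor X Y) (i : mor K X) : Prop :=
  f <o> i = 0 /\
  forall (T : C) (g : mor T X), f <o> g = 0 -> exists! h : mor T K, i <o> h = g.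

Definition is_cokernel (X Y Q : C) (f : mor X Y) (q : mor Y Q) : Prop :=
  q <o> f = 0 /\
  forall (T : C) (g : mor Y T), g <o> f = 0 -> exists! h : mor Q T, h <o> q = g.

End LinearCategory.

(* Of the axioms of an abelian category only the existence of kernels and
   cokernels is required: it is what is needed to form cohomology. *)
Record sym_tensor_category (F : fieldType) := SymTensorCategory {
  stc_base :> linear_category F;
  has_kernels : forall (X Y : stc_base) (f : mor X Y),
    exists (K : stc_base) (i : mor K X), is_kernel f i;
  has_cokernels : forall (X Y : stc_base) (f : mor X Y),
    exists (Q : stc_base) (q : mor Y Q), is_cokernel f q;
  tens : stc_base -> stc_base -> stc_base;
  tensm : forall (X X' Y Y' : stc_base),
    mor X X' -> mor Y Y' -> mor (tens X Y) (tens X' Y');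
  tensm_id : forall X Y : stc_base, tensm (idm X) (idm Y) = idm (tens X Y);
  tensm_comp : forall (X X' X'' Y Y' Y'' : stc_base)
    (f' : mor X' X'') (f : mor X X') (g' : mor Y' Y'') (g : mor Y Y'),
    tensm (f' <o> f) (g' <o> g) = tensm f' g' <o> tensm f g;
  tensm_linearl : forall (X X' Y Y' : stc_base) (c : F) (f f' : mor X X')
    (g : mor Y Y'), tensm (c *: f + f') g = c *: tensm f g + tensm f' g;
  tensm_linearr : forall (X X' Y Y' : stc_base) (c : F) (f : mor X X')
    (g g' : mor Y Y'), tensm f (c *: g + g') = c *: tensm f g + tensm f g';
  tunit : stc_base;
  assoc : forall X Y Z : stc_base, mor (tens (tens X Y) Z) (tens X (tens Y Z));
  lunit : forall X : stc_base, mor (tens tunit X) X;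
  runit : forall X : stc_base, mor (tens X tunit) X;
  braid : forall X Y : stc_base, mor (tens X Y) (tens Y X);
  assoc_iso : forall X Y Z, is_iso (assoc X Y Z);
  lunit_iso : forall X, is_iso (lunit X);
  runit_iso : forall X, is_iso (runit X);
  assoc_nat : forall (X X' Y Y' Z Z' : stc_base)
    (f : mor X X') (g : mor Y Y') (h : mor Z Z'),
    assoc X' Y' Z' <o> tensm (tensm f g) h =
    tensm f (tensm g h) <o> assoc X Y Z;
  lunit_nat : forall (X X' : stc_base) (f : mor X X'),
    lunit X' <o> tensm (idm tunit) f = f <o> lunit X;
  runit_nat : forall (X X' : stc_base) (f : mor X X'),
    runit X' <o> tensm f (idm tunit) = f <o> runit X;
  braid_nat : forall (X X' Y Y' : stc_base) (f : mor X X') (g : mor Y Y'),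
    braid X' Y' <o> tensm f g = tensm g f <o> braid X Y;
  pentagon : forall W X Y Z : stc_base,
    assoc W X (tens Y Z) <o> assoc (tens W X) Y Z =
    tensm (idm W) (assoc X Y Z) <o> assoc W (tens X Y) Z
      <o> tensm (assoc W X Y) (idm Z);
  triangle : forall X Y : stc_base,
    tensm (idm X) (lunit Y) <o> assoc X tunit Y = tensm (runit X) (idm Y);
  hexagon : forall X Y Z : stc_base,
    assoc Y Z X <o> braid X (tens Y Z) <o> assoc X Y Z =
    tensm (idm Y) (braid X Z) <o> assoc Y X Z <o> tensm (braid X Y) (idm Z);
  braid_sym : forall X Y : stc_base, braid Y X <o> braid X Y = idm (tens X Y)
}.

Notation "X <x> Y" := (tens X Y) : ring_scope.
Notation "f <xm> g" := (tensm f g) : ring_scope.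
Arguments tunit {F s}.
Arguments assoc {F s} X Y Z.
Arguments lunit {F s} X.
Arguments runit {F s} X.
Arguments braid {F s} X Y.

Record monoid_object (F : fieldType) (V : sym_tensor_category F) :=
  MonoidObject {
  mon_obj :> V;
  mmul : mor (mon_obj <x> mon_obj) mon_obj;
  mone : mor tunit mon_obj;
  monoid_mulA : mmul <o> (mmul <xm> idm mon_obj) =
    mmul <o> (idm mon_obj <xm> mmul) <o> assoc mon_obj mon_obj mon_obj;
  monoid_mul1l : mmul <o> (mone <xm> idm mon_obj) = lunit mon_obj;
  monoid_mul1r : mmul <o> (idm mon_obj <xm> mone) = runit mon_obj
}.

Arguments mmul {F V} m.
Arguments mone {F V} m.

Definition is_monoid_morphism (F : fieldType) (V : sym_tensor_category F)
    (M N : monoid_object V) (f : mor M N) : Prop :=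
  f <o> mmul M = mmul N <o> (f <xm> f) /\ f <o> mone M = mone N.

(** * Finite pointed sets *)

(* [ptmap m n] : maps [m] -> [n] preserving the base point 0, i.e. morphisms
   [n] -> [m] in Gamma. *)
Record ptmap (m n : nat) := PMap {
  pfun :> {ffun 'I_m.+1 -> 'I_n.+1};
  pfun0 : pfun ord0 == ord0
}.

Lemma pid_subproof n : [ffun j : 'I_n.+1 => j] ord0 == ord0.
Proof. by rewrite ffunE. Qed.

Definition ptmap_id n : ptmap n n := PMap (pid_subproof n).

Lemma pcomp_subproof m n r (g : ptmap n r) (f : ptmap m n) :
  [ffun j => g (f j)] ord0 == ord0.
Proof. by rewrite ffunE (eqP (pfun0 f)) (eqP (pfun0 g)). Qed.

Definition ptmap_comp m n r (g : ptmap n r) (f : ptmap m n) : ptmap m r :=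
  PMap (pcomp_subproof g f).

Lemma pperm_subproof n (s : 'S_n) :
  [ffun j => lift_perm ord0 ord0 s j] ord0 == ord0.
Proof. by rewrite ffunE lift_perm_id. Qed.

(* The permutation s of the non-base points 1, ..., n of [n]. *)
Definition pperm n (s : 'S_n) : ptmap n n := PMap (pperm_subproof s).

Definition swapn (i j : nat) : nat :=
  if j == i then i.+1 else if j == i.+1 then i else j.

Lemma ptransp_subproof n i :
  [ffun j : 'I_n.+1 => if j == ord0 then ord0 else inord (swapn i j)] ord0
    == ord0 :> 'I_n.+1.
Proof. by rewrite ffunE eqxx. Qed.

(* The transposition (i, i+1) of [n], for 1 <= i < n. *)
Definition ptransp n i : ptmap n n := PMap (ptransp_subproof n i).

(* Joyal duality sends a nondecreasing tau : [p] -> [r] to the interval map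
   <r+1> -> <p+1>, i |-> #{j | tau j < i}. *)
Definition joyal p r (tau : 'I_p.+1 -> 'I_r.+1) (i : nat) : nat :=
  #|[set j | (tau j < i)%N]|.

Lemma gamma_subproof p r (tau : 'I_p.+1 -> 'I_r.+1) :
  [ffun i : 'I_r.+1 =>
     if joyal tau i == p.+1 then ord0 else inord (joyal tau i)] ord0
    == ord0 :> 'I_p.+1.
Proof.
rewrite ffunE /joyal; set S := [set j | _].
have -> : S = set0 by apply/setP => j; rewrite !inE.
by rewrite cards0; apply/eqP/val_inj; rewrite /= inordK.
Qed.

(* The functor Delta -> Gamma on morphisms. It is only meaningful for
   nondecreasing tau. *)
Definition gamma_map p r (tau : 'I_p.+1 -> 'I_r.+1) : ptmap r p :=
  PMap (gamma_subproof tau).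

(** * Symmetric cosimplicial monoids *)

Record sym_cosimplicial_monoid (F : fieldType) (V : sym_tensor_category F) :=
  SymCosimplicialMonoid {
  eobj :> nat -> monoid_object V;
  emap : forall m n, ptmap m n -> mor (eobj n) (eobj m);
  emap_id : forall n, emap (ptmap_id n) = idm (eobj n);
  emap_comp : forall m n r (g : ptmap n r) (f : ptmap m n),
    emap (ptmap_comp g f) = emap f <o> emap g;
  emap_morphism : forall m n (f : ptmap m n), is_monoid_morphism (emap f)
}.

Section CosimplicialMonoid.
Variables (F : fieldType) (V : sym_tensor_category F).
Variable E : sym_cosimplicial_monoid V.

Definition cosimp p r (tau : 'I_p.+1 -> 'I_r.+1) : mor (E p) (E r) :=
  emap E (gamma_map tau).

(* [lift i] is the injection [n] -> [n+1] that misses i. *)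
Definition coface n (i : 'I_n.+2) : mor (E n) (E n.+1) := cosimp (lift i).

Definition differential n : mor (E n) (E n.+1) :=
  \sum_(i < n.+2) (-1) ^+ i *: coface i.

(* The differential into degree n; it is 0 for n = 0. *)
Definition differential_in n : mor (E n.-1) (E n) :=
  match n with 0 => 0 | n'.+1 => differential n' end.

Definition is_cohomology n (Z H : V) (i : mor Z (E n)) (q : mor Z H) : Prop :=
  is_kernel (differential n) i /\
  exists u : mor (E n.-1) Z, i <o> u = differential_in n /\ is_cokernel u q.

Definition transposition n (i : nat) : mor (E n) (E n) := emap E (ptransp n i).

Definition antisymmetriser n : mor (E n) (E n) :=
  (n`!%:R)^-1 *: \sum_(s : 'S_n) (-1) ^+ s *: emap E (pperm s).

(* For cohomology i : Z -> E(n), q : Z -> H in degree n: the morphism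
   j : T -> H is the inclusion of the direct summand H^{n,n} of H, that is, of
   the image of the idempotent e induced on H by the antisymmetriser. *)
Definition is_top_hodge n (Z H T : V) (i : mor Z (E n)) (q : mor Z H)
    (j : mor T H) : Prop :=
  exists (eZ : mor Z Z) (e : mor H H),
    [/\ i <o> eZ = antisymmetriser n <o> i, e <o> q = q <o> eZ &
        exists pi : mor H T, j <o> pi = e /\ pi <o> j = idm T].

(** Anti-symmetric and poly-primitive (generalised) elements a : X -> E(n) *)

Definition antisymmetric_elt n (X : V) (a : mor X (E n)) : Prop :=
  forall i : nat, (0 < i < n)%N -> transposition n i <o> a = - a.

Fixpoint hat n (i : nat) : mor (E n) (E n.+1) :=
  match i with
  | 0 => coface ord0
  | i'.+1 => transposition n.+1 i'.+1 <o> hat n i'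
  end.

Definition polyprimitive n (X : V) (a : mor X (E n)) : Prop :=
  forall i : 'I_n.+2, (0 < i < n.+1)%N ->
    coface i <o> a = hat n i.-1 <o> a + hat n i <o> a.

(* p : P -> E(n) is the inclusion of the subobject P^n(E) of anti-symmetric
   poly-primitive elements. *)
Definition is_primitive_part n (P : V) (p : mor P (E n)) : Prop :=
  [/\ antisymmetric_elt p, polyprimitive p &
      forall (X : V) (a : mor X (E n)),
        antisymmetric_elt a -> polyprimitive a ->
        exists! h : mor X P, p <o> h = a].

End CosimplicialMonoid.

(** * Linking numbers and k-commutativity *)

Section Linking.
Variable m : nat.
Local Notation T := 'I_m.+1.

Definition set_le (A B : {set T}) : bool :=
  [forall a in A, forall b in B, (a <= b)%N].

Definition set_lt (A B : {set T}) : bool :=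
  [forall a in A, forall b in B, (a < b)%N].

Definition decomposes (I : {set T}) (As : seq {set T}) : bool :=
  [&& set0 \notin As, pairwise set_lt As & \bigcup_(A <- As) A == I].

(* A_1 <= B_1 <= A_2 <= ... , the sequence of all A's and B's in alternation. *)
Definition alternates (As Bs : seq {set T}) : Prop :=
  (size Bs <= size As <= (size Bs).+1)%N /\
  forall i : nat,
    ((i < size Bs)%N -> set_le (nth set0 As i) (nth set0 Bs i)) /\
    ((i.+1 < size As)%N -> set_le (nth set0 Bs i) (nth set0 As i.+1)).

Definition linked p q (tau : 'I_p.+1 -> T) (pi : 'I_q.+1 -> T)
    (N : nat) : Prop :=
  exists As Bs : seq {set T},
    [/\ decomposes [set tau j | j : 'I_p.+1] As,
        decomposes [set pi j | j : 'I_q.+1] Bs,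
        (size As + size Bs = N.+1)%N &
        alternates As Bs \/ alternates Bs As].

Definition is_lk p q (tau : 'I_p.+1 -> T) (pi : 'I_q.+1 -> T)
    (N : nat) : Prop :=
  linked tau pi N /\ forall N', linked tau pi N' -> (N <= N')%N.

End Linking.

Definition k_commutative (F : fieldType) (V : sym_tensor_category F)
    (E : sym_cosimplicial_monoid V) (k : nat) : Prop :=
  forall (m p q N : nat) (tau : 'I_p.+1 -> 'I_m.+1) (pi : 'I_q.+1 -> 'I_m.+1),
    {homo tau : i j / (i <= j)%N} -> {homo pi : i j / (i <= j)%N} ->
    is_lk tau pi N -> (N <= k)%N ->
    mmul (E m) <o> (cosimp E tau <xm> cosimp E pi) =
    mmul (E m) <o> braid (E m) (E m) <o> (cosimp E tau <xm> cosimp E pi).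

(** * Lattice paths and the bracket *)

(* Words in the letters 1 and 2 are bit sequences: [true] is the letter 1 and
   [false] the letter 2. *)

(* The j-th point of the path, 0 <= j <= size w, is a corner if the letters
   before and after it differ. *)
Definition corner (w : seq bool) (j : nat) : bool :=
  (0 < j < size w)%N && (nth true w j.-1 != nth true w j).

(* A maximal run other than the first and the last lies between two corners;
   it has length 1 exactly when these are adjacent. *)
Definition smooth (w : seq bool) : bool :=
  all (fun j => ~~ (corner w j && corner w j.+1)) (iota 0 (size w)).

Definition is_path (p q k : nat) (w : seq bool) : bool :=
  [&& count_mem true w == p.+1, count_mem false w == q.+1,
      count (corner w) (iota 0 (size w)) == k.+1 & smooth w].

Definition points (w : seq bool) : seq nat :=
  [seq j <- iota 0 (size w).+1 | ~~ corner w j].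

Definition xcoord (w : seq bool) (i : nat) : nat :=
  count_mem true (take (nth 0%N (points w) i) w).

Definition ycoord (w : seq bool) (i : nat) : nat :=
  count_mem false (take (nth 0%N (points w) i) w).

(* j |-> the unique i with x i <= j < x i.+1; the default is never used on
   the coordinate functions of a path. *)
Definition locate (x : nat -> nat) p r (j : 'I_p.+1) : 'I_r.+1 :=
  odflt ord0 [pick i : 'I_r.+1 | (x i <= j < x i.+1)%N].

(* The number of pairs (letter 2 before letter 1). *)
Definition inversions (w : seq bool) : nat :=
  (\sum_(i < size w) \sum_(j < size w)
     [&& i < j, ~~ nth true w i & nth true w j])%N.

Section Bracket.
Variables (F : fieldType) (V : sym_tensor_category F).
Variable E : sym_cosimplicial_monoid V.

Definition path_op p q r (w : seq bool) : mor (E p <x> E q) (E r) :=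
  let e1 := cosimp E (@locate (xcoord w) p r) in
  let e2 := cosimp E (@locate (ycoord w) q r) in
  if head true w then mmul (E r) <o> (e1 <xm> e2)
  else mmul (E r) <o> (e2 <xm> e1) <o> braid (E p) (E q).

Definition path_sign p q k (w : seq bool) : F :=
  (-1) ^ ((p%:Z - 1) * (q%:Z - 1) + (inversions w)%:Z
          + (if head true w then 0 else k%:Z)).

(* The sum is empty when p + q < k. *)
Definition bracket k p q : mor (E p <x> E q) (E (p + q - k)%N) :=
  \sum_(w : (p + q).+2.-tuple bool | is_path p q k w)
    path_sign p q k w *: path_op p q (p + q - k) w.

End Bracket.

(* Main.v *)
Require Import Defs.
From mathcomp Require Import all_boot all_order all_fingroup all_algebra.
From mathcomp Require Import zify.

Set Implicit Arguments.
Unset Strict Implicit.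
Unset Printing Implicit Defensive.

Import GRing.Theory.
Local Open Scope ring_scope.

(** An element a of E(n) is best thought of as a function a(x_1, ..., x_n) of n
elements of a commutative monoid: a pointed map from [m] to [n] substitutes for
each x_i the sum of the variables lying over i. In this language a is
poly-primitive when it is additive in each variable, and the differential is the
bar differential
  (da)(x_0, ..., x_n) = a(x_1, ..., x_n) - a(x_0 + x_1, ..., x_n) + ...
                        +- a(x_0, ..., x_(n-1)).

For the first part, additivity makes da telescope to 0
([polyprimitive_cocycle]), and the antisymmetriser kills coboundaries, because
the inner cofaces are symmetric in two variables while the two outer ones cancel
([alt_differential]). The substance is that the antisymmetrisation of a cocycle
z is additive in each variable ([alt_cocycle_additive]). Let x_l and x_(l+1) be two
of the variables x_0, ..., x_n, and sum the equation dz = 0, with signs, over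
all the orderings of the variables in which x_l comes before x_(l+1). A term
that merges two variables other than these cancels against the ordering in which
the two are exchanged; the terms that merge x_l and x_(l+1) add up to the
antisymmetrisation of z at x_l + x_(l+1). Moving the first variable to the end
cancels the term that forgets the first variable against a term that forgets the
last one, unless this breaks the order of x_l and x_(l+1): what survives forgets
x_l in first position or x_(l+1) in last position, and adds up to the
antisymmetrisation of z in the remaining variables. Hence antisymmetrisation
sends cocycles into the primitive part P. As it kills coboundaries, it induces a
map from the cohomology to P that is the identity on P, and this exhibits P as
the image of the antisymmetriser ([primitive_part_top_hodge]).

For the second part, a term of the bracket of a and b is a product, in some
order, of a and b after a substitution of the r = m + n - k variables. Expanding
by additivity ([polyprimitive_ind]), one may assume that a reads m distinct
variables and b reads n distinct variables. As m + n = r + k with k at least 2,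
a and b have two variables in common. Exchanging these changes the sign of a
and that of b, hence fixes their product, while it changes the sign of the
antisymmetriser; so the antisymmetrisation of the product is 0
([alt_product_zero]). *)

(** * Linearity of composition and of the tensor product *)

Section Linearity.
Variables (F : fieldType) (C : linear_category F).
Variables (X Y Z : C).
Implicit Types (f : mor X Y) (g : mor Y Z) (c : F).

Lemma ccompDl g g' f : (g + g') <o> f = g <o> f + g' <o> f.
Proof. by rewrite -[g]scale1r ccomp_linearl !scale1r. Qed.

Lemma ccompDr g f f' : g <o> (f + f') = g <o> f + g <o> f'.
Proof. by rewrite -[f]scale1r ccomp_linearr !scale1r. Qed.

Lemma ccomp0l f : (0 : mor Y Z) <o> f = 0.
Proof. by apply: (addrI (0 <o> f)); rewrite -ccompDl !addr0. Qed.

Lemma ccomp0r g : g <o> (0 : mor X Y) = 0.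
Proof. by apply: (addrI (g <o> 0)); rewrite -ccompDr !addr0. Qed.

Lemma ccompZl c g f : (c *: g) <o> f = c *: (g <o> f).
Proof. by rewrite -[c *: g]addr0 ccomp_linearl ccomp0l addr0. Qed.

Lemma ccompZr c g f : g <o> (c *: f) = c *: (g <o> f).
Proof. by rewrite -[c *: f]addr0 ccomp_linearr ccomp0r addr0. Qed.

Lemma ccompNl g f : (- g) <o> f = - (g <o> f).
Proof. by rewrite -scaleN1r ccompZl scaleN1r. Qed.

Lemma ccompNr g f : g <o> (- f) = - (g <o> f).
Proof. by rewrite -scaleN1r ccompZr scaleN1r. Qed.

Lemma ccomp_suml (I : Type) (r : seq I) (P : pred I) (G : I -> mor Y Z) f :
  (\sum_(i <- r | P i) G i) <o> f = \sum_(i <- r | P i) G i <o> f.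
Proof.
exact: (big_morph (fun g => g <o> f) (fun g g' => ccompDl g g' f) (ccomp0l f)).
Qed.

Lemma ccomp_sumr (I : Type) (r : seq I) (P : pred I) (G : I -> mor X Y) g :
  g <o> (\sum_(i <- r | P i) G i) = \sum_(i <- r | P i) g <o> G i.
Proof. exact: (big_morph (ccomp g) (ccompDr g) (ccomp0r g)). Qed.

End Linearity.

Section TensorLinearity.
Variables (F : fieldType) (V : sym_tensor_category F) (X X' Y Y' : V).
Implicit Types (f : mor X X') (g : mor Y Y').

Lemma tensmDl f f' g : (f + f') <xm> g = f <xm> g + f' <xm> g.
Proof. by rewrite -[f]scale1r tensm_linearl !scale1r. Qed.

Lemma tensmDr f g g' : f <xm> (g + g') = f <xm> g + f <xm> g'.
Proof. by rewrite -[g]scale1r tensm_linearr !scale1r. Qed.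

Lemma tensm0l g : (0 : mor X X') <xm> g = 0.
Proof. by apply: (addrI (0 <xm> g)); rewrite -tensmDl !addr0. Qed.

Lemma tensm0r f : f <xm> (0 : mor Y Y') = 0.
Proof. by apply: (addrI (f <xm> 0)); rewrite -tensmDr !addr0. Qed.

Lemma tensmNN f g : (- f) <xm> (- g) = f <xm> g.
Proof.
rewrite -(scaleN1r f) -(scaleN1r g) -[-1 *: f]addr0 tensm_linearl tensm0l.
by rewrite -[-1 *: g]addr0 tensm_linearr tensm0r !addr0 !scaleN1r opprK.
Qed.

End TensorLinearity.

Section Cancellation.
Variables (F : fieldType) (C : linear_category F).

Lemma kernel_mono (K X Y : C) (f : mor X Y) (i : mor K X) (T : C)
    (h h' : mor T K) :
  is_kernel f i -> i <o> h = i <o> h' -> h = h'.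
Proof.
case=> fi0 univ eq_ih.
have [|u [_ uniq_u]] := univ T (i <o> h'); first by rewrite ccompA fi0 ccomp0l.
by rewrite -(uniq_u h eq_ih) (uniq_u h').
Qed.

Lemma cokernel_epi (X Y Q : C) (f : mor X Y) (q : mor Y Q) (T : C)
    (h h' : mor Q T) :
  is_cokernel f q -> h <o> q = h' <o> q -> h = h'.
Proof.
case=> qf0 univ eq_hq.
have [|u [_ uniq_u]] := univ T (h' <o> q); first by rewrite -ccompA qf0 ccomp0r.
by rewrite -(uniq_u h eq_hq) (uniq_u h').
Qed.

End Cancellation.

(** * Pointed maps *)

Lemma ptmapP m n (f g : ptmap m n) : f =1 g -> f = g.
Proof.
case: f g => [f f0] [g g0] /= /ffunP eq_fg; rewrite eq_fg in f0 *.
by congr PMap; apply: bool_irrelevance.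
Qed.

Lemma ptmap0 m n (f : ptmap m n) : f ord0 = ord0.
Proof. exact: (eqP (pfun0 f)). Qed.

Lemma ptmap_compE m n r (g : ptmap n r) (f : ptmap m n) x :
  ptmap_comp g f x = g (f x).
Proof. by rewrite ffunE. Qed.

Lemma pointed_subproof m n (h : 'I_m.+1 -> 'I_n.+1) :
  [ffun x => if x == ord0 then ord0 else h x] ord0 == ord0.
Proof. by rewrite ffunE eqxx. Qed.

Definition pointed m n (h : 'I_m.+1 -> 'I_n.+1) : ptmap m n :=
  PMap (pointed_subproof h).

Lemma pointedE m n (h : 'I_m.+1 -> 'I_n.+1) x :
  x != ord0 -> pointed h x = h x.
Proof. by move=> nz_x; rewrite ffunE (negPf nz_x). Qed.

Lemma ptmap_nzP m n (f g : ptmap m n) :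
  (forall x : 'I_m, f (lift ord0 x) = g (lift ord0 x)) -> f = g.
Proof.
move=> eq_fg; apply: ptmapP => x.
by case: (unliftP ord0 x) => [y ->|->]; rewrite ?eq_fg // !ptmap0.
Qed.

Lemma ppermE n (s : 'S_n) (x : 'I_n) :
  pperm s (lift ord0 x) = lift ord0 (s x).
Proof. by rewrite ffunE lift_perm_lift. Qed.

Lemma pperm1 n : pperm (1%g : 'S_n) = ptmap_id n.
Proof. by apply: ptmap_nzP => x; rewrite ppermE ffunE perm1. Qed.

Lemma ppermM n (s t : 'S_n) : pperm (s * t)%g = ptmap_comp (pperm t) (pperm s).
Proof. by apply: ptmap_nzP => x; rewrite ptmap_compE !ppermE permM. Qed.

(** In the point of view where an element of E(n) is a function of n variables,
[collapse l y] substitutes the old variables for all new ones but the l-th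
(counted from 0), and the value of the y-th old variable for the l-th one, or
the neutral value when y is the base point. All cofaces and all the maps [hat]
are of this form, and the way permutations move past such maps does not depend
on which of them is considered. *)
Definition collapse n (l : 'I_n.+1) (y : 'I_n.+1) : ptmap n.+1 n :=
  pointed (fun j => if unlift ord0 j is Some k then
                      if unlift l k is Some x then lift ord0 x else y
                    else ord0).

Lemma collapse_lift n (l y : 'I_n.+1) (x : 'I_n) :
  collapse l y (lift ord0 (lift l x)) = lift ord0 x.
Proof. by rewrite pointedE // !liftK. Qed.

Lemma collapse_id n (l y : 'I_n.+1) : collapse l y (lift ord0 l) = y.
Proof. by rewrite pointedE // !liftK unlift_none. Qed.

Lemma pperm_collapse n (s : 'S_n) (l l' y : 'I_n.+1) :
  ptmap_comp (pperm s) (collapse l y) =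
  ptmap_comp (collapse l' (pperm s y)) (pperm (lift_perm l l' s)).
Proof.
apply: ptmap_nzP => x; rewrite !ptmap_compE ppermE.
case: (unliftP l x) => [x' ->|->].
  by rewrite collapse_lift lift_perm_lift collapse_lift ppermE.
by rewrite collapse_id lift_perm_id collapse_id.
Qed.

(** An inner coface is invariant under the exchange of the two variables that it
merges. *)
Lemma collapse_tperm n (l : 'I_n) :
  ptmap_comp (collapse (lift ord0 l) (lift ord0 l))
    (pperm (tperm (lift (lift ord0 l) l) (lift ord0 l))) =
  collapse (lift ord0 l) (lift ord0 l).
Proof.
apply: ptmap_nzP => x; rewrite ptmap_compE ppermE; case: tpermP => // ->.
  by rewrite collapse_id collapse_lift.
by rewrite collapse_id collapse_lift.
Qed.

(** The dual of the injection missing i is the surjection merging the values i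
and i + 1. *)
Lemma joyal_lift n (i j : 'I_n.+2) : joyal (lift i) j = unbump i j.
Proof.
rewrite /joyal; have le_n : (unbump i j <= n.+1)%N.
  by have := ltn_ord j; rewrite /unbump; lia.
have inj_w : injective (widen_ord le_n) by move=> x y [/val_inj].
rewrite -[RHS]card_ord -(card_imset _ inj_w).
apply: eq_card => k; rewrite inE; apply/idP/imsetP.
  move=> lt_k; have lt_k' : (k < unbump i j)%N.
    by move: lt_k; rewrite /= /bump /unbump; lia.
  by exists (Ordinal lt_k') => //; apply: val_inj.
by case=> x _ ->; have := ltn_ord x; rewrite /= /bump /unbump; lia.
Qed.

Lemma gamma_liftE n (i j : 'I_n.+2) :
  gamma_map (lift i) j =
  (if unbump i j == n.+1 then 0 else unbump i j)%N :> nat.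
Proof.
rewrite ffunE joyal_lift; case: eqP => // ne_j; rewrite inordK //.
by have := ltn_ord j; move: ne_j; rewrite /unbump; lia.
Qed.

Lemma gamma_lift_first n : gamma_map (@lift n.+2 ord0) = collapse ord0 ord0.
Proof.
apply: ptmap_nzP => x; apply: val_inj; rewrite /= gamma_liftE.
case: (unliftP ord0 x) => [[y lt_y] ->|->];
  rewrite ?collapse_lift ?collapse_id //=.
by rewrite /= in lt_y; rewrite /bump /unbump /=; case: eqP; lia.
Qed.

Lemma gamma_lift_last n :
  gamma_map (@lift n.+2 ord_max) = collapse ord_max ord0.
Proof.
apply: ptmap_nzP => x; apply: val_inj; rewrite /= gamma_liftE.
case: (unliftP ord_max x) => [[y lt_y] ->|->];
  rewrite ?collapse_lift ?collapse_id /=.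
  by rewrite /= in lt_y; rewrite /bump /unbump /=; case: eqP; lia.
by rewrite /bump /unbump /=; case: eqP; lia.
Qed.

Lemma gamma_lift_inner n (l : 'I_n) (i : 'I_n.+2) :
  i = l.+1 :> nat -> gamma_map (lift i) = collapse (lift ord0 l) (lift ord0 l).
Proof.
move=> def_i; apply: ptmap_nzP => x; apply: val_inj.
rewrite /= gamma_liftE def_i.
have lt_l := ltn_ord l; case: (unliftP (lift ord0 l) x) => [[y lt_y] ->|->];
  rewrite ?collapse_lift ?collapse_id /=.
  by rewrite /= in lt_y; rewrite /bump /unbump /=; case: eqP; lia.
by rewrite /bump /unbump /=; case: eqP; lia.
Qed.

Lemma ptransp_tperm n (i j : 'I_n) :
  j = i.+1 :> nat -> ptransp n i.+1 = pperm (tperm i j).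
Proof.
move=> def_j; apply: ptmap_nzP => x; apply: val_inj; rewrite ppermE ffunE /=.
have lt_i := ltn_ord i; have lt_j := ltn_ord j; have lt_x := ltn_ord x.
rewrite inordK /swapn /bump /=; last by case: eqP; try case: eqP; lia.
case: tpermP => [->|->|ne_i ne_j].
- by rewrite eqxx def_j.
- by rewrite def_j; case: eqP; try case: eqP; lia.
- have {}ne_i : x <> i :> nat by move/val_inj.
  have {}ne_j : x <> j :> nat by move/val_inj.
  by case: eqP; try case: eqP; lia.
Qed.

Lemma collapse_ptransp n (i j : 'I_n.+1) :
  j = i.+1 :> nat ->
  ptmap_comp (collapse i ord0) (ptransp n.+1 i.+1) = collapse j ord0.
Proof.
move=> def_j; rewrite (ptransp_tperm def_j).
have -> : tperm i j = lift_perm j i 1%g.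
  apply/permP => x; case: (unliftP j x) => [[y lt_y] ->|->].
    rewrite lift_perm_lift perm1; apply: val_inj.
    case: tpermP => [/(congr1 val)|/(congr1 val)|ne_i _];
      rewrite /= /bump; try lia.
    have {}ne_i : bump j y <> i :> nat.
      by move=> eq_i; apply: ne_i; apply: val_inj.
    by move: ne_i; rewrite /bump; lia.
  by rewrite lift_perm_id tpermR.
have := pperm_collapse 1%g j i ord0.
rewrite ptmap0 => <-; apply: ptmap_nzP => x.
by rewrite ptmap_compE pperm1 ffunE.
Qed.

(** * Sums over permutations *)

Lemma lift_perm_onto n (i j : 'I_n.+1) (w : 'S_n.+1) :
  w i = j -> exists s : 'S_n, lift_perm i j s = w.
Proof.
move=> wi; pose h k := odflt k (unlift j (w (lift i k))).
have hE k : lift j (h k) = w (lift i k).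
  rewrite /h; case: unliftP => //= /esym; rewrite -wi => /perm_inj/eqP.
  by rewrite (negPf (neq_lift i k)).
have inj_h : injective h.
  by move=> k k' eq_h; apply/(@lift_inj _ i)/(@perm_inj _ w); rewrite -!hE eq_h.
exists (perm inj_h); apply/permP => x.
case: (unliftP i x) => [k ->|->]; last by rewrite lift_perm_id wi.
by rewrite lift_perm_lift permE hE.
Qed.

Lemma sum_lift_perm n (i j : 'I_n.+1) (M : nmodType) (G : 'S_n.+1 -> M) :
  \sum_(w : 'S_n.+1 | w i == j) G w = \sum_(s : 'S_n) G (lift_perm i j s).
Proof.
have inj_lift : injective (@lift_perm n i j).
  move=> s t eq_st; apply/permP => x; apply: (@lift_inj _ j).
  by rewrite -!(lift_perm_lift i) eq_st.
rewrite (reindex_onto (lift_perm i j)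
  (fun w => odflt 1%g [pick s | lift_perm i j s == w])) /=.
  apply: eq_bigl => s; rewrite lift_perm_id eqxx /=.
  by case: pickP => [t /eqP/inj_lift->|/(_ s)]; rewrite eqxx.
move=> w /eqP/lift_perm_onto[s def_w].
by case: pickP => [t /eqP|/(_ s)] //; rewrite def_w eqxx.
Qed.

(** Two consecutive values compare in the same way with any third one; the pair
(a, b) itself, whose order is reversed, is excluded on both sides. *)
Lemma tperm_succ_order n (a b x y : 'I_n) :
  b = a.+1 :> nat -> x <> y ->
  (tperm a b x < tperm a b y)%N && ~~ ((tperm a b y == b) && (tperm a b x == a))
  = (x < y)%N && ~~ ((y == b) && (x == a)).
Proof.
move=> def_b ne_xy; have {}ne_xy : x <> y :> nat by move/val_inj.
have tE u : val (tperm a b u) =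
    if val u == val a then val b else if val u == val b then val a else val u.
  by rewrite permE /= -!val_eqE; case: eqP => // _; case: eqP.
rewrite -!val_eqE !tE /= def_b; move: (val x) (val y) ne_xy => u v ne_uv.
by do ?[case: eqP => ?]; lia.
Qed.

(** * The symmetric group actions *)

Section Cosimplicial.
Variables (F : fieldType) (V : sym_tensor_category F).
Variable E : sym_cosimplicial_monoid V.

Local Notation act s := (emap E (pperm s)).

Lemma act1 n : act (1%g : 'S_n) = Defs.idm (E n).
Proof. by rewrite pperm1 emap_id. Qed.

Lemma actM n (s t : 'S_n) : act (s * t)%g = act s <o> act t.
Proof. by rewrite ppermM emap_comp. Qed.

Lemma coface_first n : coface E ord0 = emap E (@collapse n ord0 ord0).
Proof. by rewrite /coface /cosimp gamma_lift_first. Qed.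

Lemma coface_last n : coface E ord_max = emap E (@collapse n ord_max ord0).
Proof. by rewrite /coface /cosimp gamma_lift_last. Qed.

Lemma coface_inner n (l : 'I_n) (i : 'I_n.+2) :
  i = l.+1 :> nat ->
  coface E i = emap E (collapse (lift ord0 l) (lift ord0 l)).
Proof. by move=> def_i; rewrite /coface /cosimp (gamma_lift_inner def_i). Qed.

Lemma hatE n (i : 'I_n.+1) : hat E n i = emap E (collapse i ord0).
Proof.
case: i => i; elim: i => [|i IHi] lt_i /=.
  by rewrite coface_first; congr (emap E (collapse _ _)); apply: val_inj.
by rewrite (IHi (ltnW lt_i)) -emap_comp (@collapse_ptransp _ _ (Ordinal lt_i)).
Qed.

Lemma act_collapse n (s : 'S_n) (l l' y : 'I_n.+1) :
  act (lift_perm l l' s) <o> emap E (collapse l' (pperm s y)) =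
  emap E (collapse l y) <o> act s.
Proof. by rewrite -!emap_comp (pperm_collapse _ _ l'). Qed.

Lemma act_collapse0 n (s : 'S_n) (l l' : 'I_n.+1) :
  act (lift_perm l l' s) <o> emap E (collapse l' ord0) =
  emap E (collapse l ord0) <o> act s.
Proof. by rewrite -[in RHS](act_collapse _ _ l') ptmap0. Qed.

Lemma alt_actr n (s : 'S_n) :
  antisymmetriser E n <o> act s = (-1) ^+ s *: antisymmetriser E n.
Proof.
rewrite /antisymmetriser ccompZl ccomp_suml [RHS]scalerA mulrC -scalerA.
congr (_ *: _).
rewrite [in RHS](reindex_inj (mulIg s)) scaler_sumr; apply: eq_bigr => t _.
by rewrite ccompZl -actM scalerA odd_permM signr_addb mulrC -mulrA -signr_addb
  addbb mulr1.
Qed.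

Lemma alt_actl n (s : 'S_n) :
  act s <o> antisymmetriser E n = (-1) ^+ s *: antisymmetriser E n.
Proof.
rewrite /antisymmetriser ccompZr ccomp_sumr [RHS]scalerA mulrC -scalerA.
congr (_ *: _).
rewrite [in RHS](reindex_inj (mulgI s)) scaler_sumr; apply: eq_bigr => t _.
by rewrite ccompZr -actM scalerA odd_permM signr_addb mulrA -signr_addb
  addbb mul1r.
Qed.

Lemma transpositionE n (i j : 'I_n) :
  j = i.+1 :> nat -> transposition E n i.+1 = act (tperm i j).
Proof. by move=> def_j; rewrite /transposition (ptransp_tperm def_j). Qed.

(** Adjacent transpositions generate the symmetric group: a longer
transposition is a conjugate of a shorter one by an adjacent one. *)
Lemma antisymmetric_act n (X : V) (a : mor X (E n)) :
  antisymmetric_elt a -> forall s : 'S_n, act s <o> a = (-1) ^+ s *: a.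
Proof.
move=> anti_a.
pose good (s : 'S_n) := act s <o> a = (-1) ^+ s *: a.
have goodM s t : good s -> good t -> good (s * t)%g.
  rewrite /good => gs gt; rewrite actM -ccompA gt ccompZr gs scalerA.
  by rewrite odd_permM signr_addb mulrC.
have good_tperm d (i j : 'I_n) : j = (i + d.+1)%N :> nat -> good (tperm i j).
  elim: d j => [|d IHd] j def_j.
    have ne_ij : i != j by apply/eqP => /(congr1 val) /=; lia.
    rewrite addn1 in def_j; rewrite /good odd_tperm ne_ij expr1 scaleN1r.
    by rewrite -(transpositionE def_j) anti_a // -def_j ltn_ord def_j.
  have lt_m : (i + d.+1 < n)%N by have := ltn_ord j; lia.
  pose m := Ordinal lt_m.
  have ne_im : i != m by apply/eqP => /(congr1 val) /=; lia.
  have ne_ij : i != j by apply/eqP => /(congr1 val) /=; lia.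
  have ne_mj : m != j by apply/eqP => /(congr1 val) /=; lia.
  have -> : tperm i j = (tperm m j * tperm i m * tperm m j)%g.
    rewrite -{1}[tperm m j]tpermV -mulgA.
    rewrite -[RHS]/(tperm i m ^ tperm m j)%g tpermJ.
    by rewrite tpermL tpermD // eq_sym.
  have good_mj : good (tperm m j).
    have def_j' : j = m.+1 :> nat by rewrite /=; lia.
    rewrite /good odd_tperm ne_mj expr1 scaleN1r -(transpositionE def_j').
    by rewrite anti_a // -def_j' ltn_ord def_j'.
  have good_im : good (tperm i m) by apply: IHd.
  exact: goodM (goodM _ _ good_mj good_im) good_mj.
move=> s; have [ts -> ] := prod_tpermP s; rewrite -/(good _).
elim: ts => [|[i j] ts IHts] /=; first by
  rewrite big_nil /good act1 ccomp_idl odd_perm1 scale1r.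
case/andP=> /= ne_ij /IHts good_ts; rewrite big_cons; apply: goodM => //=.
have [lt_ij|lt_ji|/val_inj eq_ij] := ltngtP i j.
- by apply: (good_tperm (j - i).-1); lia.
- by rewrite tpermC; apply: (good_tperm (i - j).-1); lia.
- by rewrite /dpair /= eq_ij eqxx in ne_ij.
Qed.

Hypothesis charF : [pchar F] =i pred0.

Lemma natF_neq0 n : n.+1%:R != 0 :> F.
Proof. by rewrite (proj1 (pcharf0P F) charF). Qed.

Lemma eq_opp0 (X Y : V) (f : mor X Y) : f = - f -> f = 0.
Proof.
move/eqP; rewrite -subr_eq0 opprK -mulr2n -scaler_nat scaler_eq0.
by rewrite (negPf (natF_neq0 1)) => /eqP.
Qed.

Lemma alt_antisymmetric n : antisymmetric_elt (antisymmetriser E n).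
Proof.
move=> i' /andP[i_gt0 lt_i]; case: i' => // i' in i_gt0 lt_i *.
rewrite (@transpositionE n (Ordinal (ltnW lt_i)) (Ordinal lt_i)) //.
rewrite alt_actl odd_tperm -val_eqE /= ltn_eqF //.
by rewrite expr1 scaleN1r.
Qed.

Lemma alt_id n (X : V) (a : mor X (E n)) :
  antisymmetric_elt a -> antisymmetriser E n <o> a = a.
Proof.
move=> anti_a; rewrite /antisymmetriser ccompZl ccomp_suml.
rewrite (eq_bigr (fun=> a)) => [|s _]; last first.
  by rewrite ccompZl antisymmetric_act // scalerA -signr_addb addbb scale1r.
rewrite sumr_const card_Sn -scaler_nat scalerA mulVf ?scale1r //.
by rewrite -(prednK (fact_gt0 n)) natF_neq0.
Qed.

(** * The differential *)

Lemma coface_last_first n :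
  coface E ord0 =
  act (lift_perm ord0 ord_max (1%g : 'S_n)) <o> coface E ord_max.
Proof. by rewrite coface_first coface_last act_collapse0 act1 ccomp_idr. Qed.

Lemma act_coface_inner n (l : 'I_n) (i : 'I_n.+2) :
  i = l.+1 :> nat ->
  act (tperm (lift (lift ord0 l) l) (lift ord0 l)) <o> coface E i = coface E i.
Proof.
by move=> def_i; rewrite (coface_inner def_i) -emap_comp collapse_tperm.
Qed.

Lemma sum_cofaces n (M : nmodType) (G : 'I_n.+2 -> M) :
  \sum_(i < n.+2) G i =
  G ord0 + \sum_(l < n) G (lift ord0 (widen_ord (leqnSn n) l)) + G ord_max.
Proof.
rewrite big_ord_recl big_ord_recr /= addrA; congr (_ + _ + _).
by congr (G _); apply: val_inj.
Qed.

(** Every inner coface is fixed by a transposition, and the first and the last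
one differ by a cycle of sign (-1)^n, so that their contributions cancel. *)
Lemma alt_differential n : antisymmetriser E n.+1 <o> differential E n = 0.
Proof.
rewrite ccomp_sumr sum_cofaces big1 => [|l _].
  rewrite addr0 !ccompZr coface_last_first ccompA alt_actr ccompZl scalerA.
  by rewrite -scalerDl odd_lift_perm odd_perm1 /= addbF signr_odd mul1r
    exprS mulN1r subrr scale0r.
rewrite ccompZr; have def_l : lift ord0 (widen_ord (leqnSn n) l) = l.+1 :> nat.
  by [].
set i := lift _ _ in def_l *.
suff -> : antisymmetriser E n.+1 <o> coface E i = 0.
  by rewrite scaler0.
apply: eq_opp0; rewrite -{1}(act_coface_inner def_l) ccompA alt_actr odd_tperm.
by rewrite eq_sym neq_lift expr1 scaleN1r ccompNl.
Qed.

Lemma alt_differential_in n : antisymmetriser E n <o> differential_in E n = 0.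
Proof. by case: n => [|n] /=; [rewrite ccomp0r | exact: alt_differential]. Qed.

(** The alternating sum of the defining relations telescopes. *)
Lemma polyprimitive_cocycle n (X : V) (a : mor X (E n)) :
  polyprimitive a -> differential E n <o> a = 0.
Proof.
move=> prim_a.
pose h (i : nat) : mor X (E n.+1) := (-1) ^+ i *: (hat E n i <o> a).
rewrite ccomp_suml big_ord_recl big_ord_recr /=.
have -> : \sum_(i < n) (((-1) ^+ lift ord0 (widen_ord (leqnSn n) i) *:
    coface E (lift ord0 (widen_ord (leqnSn n) i))) <o> a) =
    \sum_(i < n) (h i.+1 - h i).
  apply: eq_bigr => i _; rewrite ccompZl prim_a /=; last by rewrite !ltnS.
  by rewrite /h /= add0n exprS mulN1r !scaleNr scalerDr opprD addrC.
rewrite -(big_mkord xpredT (fun i => h i.+1 - h i)) telescope_sumr //.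
have -> : lift ord0 (@ord_max n) = ord_max by apply: val_inj.
rewrite coface_last -(hatE (@ord_max n)) !ccompZl expr0 scale1r /=.
have -> : (-1) ^+ n.+1 *: (hat E n n <o> a) = - h n.
  by rewrite exprS mulN1r scaleNr.
have -> : coface E ord0 <o> a = h 0 by rewrite /h expr0 scale1r.
by rewrite addrAC subrr add0r subrr.
Qed.

(** * The antisymmetrisation of a cocycle *)

Section AltCocycle.
Variables (n : nat) (l : 'I_n) (X : V) (z : mor X (E n)).

Let l1 : 'I_n.+1 := lift ord0 l.
Let l0 : 'I_n.+1 := lift l1 l.

Let val_l0 : l0 = l :> nat.
Proof. by rewrite /= /bump /=; lia. Qed.

Let hat_l0 : hat E n l = emap E (collapse l0 ord0).
Proof. by rewrite -val_l0 hatE. Qed.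

Let hat_l1 : hat E n l.+1 = emap E (collapse l1 ord0).
Proof. exact: (hatE l1). Qed.

(* A permutation w is read as an ordering of the variables, w k being the
   position of the variable k. Additivity is to be shown for the merging of the
   consecutive variables l0 and l1. *)
Let in_order (w : 'S_n.+1) := (w l0 < w l1)%N.

Let twist (w : 'S_n.+1) (c : mor (E n) (E n.+1)) : mor X (E n.+1) :=
  (-1) ^+ w *: (act w <o> (c <o> z)).

Let ordered_sum c := \sum_(w | in_order w) twist w c.

Let full_sum (c : mor (E n) (E n.+1)) : mor X (E n.+1) :=
  \sum_(s : 'S_n) (-1) ^+ s *: (c <o> (act s <o> z)).

(** When the coface acts at the position of the variable k, moving the ordering
past it leaves a permutation s of the remaining variables, and the sign of the
displacement of k to its position k'. *)
Lemma twist_lift_perm (s : 'S_n) (k k' y : 'I_n.+1) :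
  twist (lift_perm k k' s) (emap E (collapse k' (pperm s y))) =
  ((-1) ^+ k * (-1) ^+ k') *:
    ((-1) ^+ s *: (emap E (collapse k y) <o> (act s <o> z))).
Proof.
rewrite /twist ccompA act_collapse -ccompA odd_lift_perm !signr_addb.
by rewrite !signr_odd !scalerA.
Qed.

Lemma sum_twist_lift_perm0 (k k' : 'I_n.+1) :
  \sum_(w : 'S_n.+1 | w k == k') twist w (emap E (collapse k' ord0)) =
  ((-1) ^+ k * (-1) ^+ k') *: full_sum (emap E (collapse k ord0)).
Proof.
rewrite sum_lift_perm /full_sum scaler_sumr; apply: eq_bigr => s _.
by rewrite -twist_lift_perm ptmap0.
Qed.

(** An inner coface contributes the orderings in which l0 and l1 are the two
variables that it merges: all others cancel in pairs. *)
Lemma ordered_sum_inner (m : 'I_n) (i : 'I_n.+2) :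
  i = m.+1 :> nat ->
  ordered_sum (coface E i) =
  ((-1) ^+ l1 * (-1) ^+ i) *: \sum_(s : 'S_n | s l == m)
    ((-1) ^+ s *: (emap E (collapse l1 l1) <o> (act s <o> z))).
Proof.
move=> def_i; pose m1 : 'I_n.+1 := lift ord0 m; pose m0 : 'I_n.+1 := lift m1 m.
have val_m0 : m0 = m :> nat by rewrite /= /bump /=; lia.
have val_m1 : m1 = m.+1 :> nat by [].
pose merged (w : 'S_n.+1) := (w l1 == m1) && (w l0 == m0).
rewrite /ordered_sum (bigID merged) /= /merged.
rewrite [X in _ + X](_ : _ = 0) ?addr0; last first.
  apply: eq_opp0; rewrite {1}(reindex_inj (mulIg (tperm m0 m1))) /= -sumrN.
  apply: eq_big => [w|w _].
    rewrite /in_order !permM tperm_succ_order ?val_m0 //.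
    by move/perm_inj/(congr1 (@nat_of_ord _)); rewrite val_l0 /= /bump /=; lia.
  have odd_t : tperm m0 m1 = true :> bool.
    rewrite odd_tperm; apply/eqP => /(congr1 (@nat_of_ord _)).
    by rewrite val_m0 /= /bump /=; lia.
  rewrite /twist odd_permM odd_t addbT signrN scaleNr actM -ccompA.
  by rewrite (ccompA (act (tperm m0 m1))) (act_coface_inner def_i).
rewrite (eq_bigl (fun w : 'S_n.+1 => (w l1 == m1) && (w l0 == m0))); last first.
  move=> w /=; apply: andb_idl => /andP[/eqP w1 /eqP w0].
  by rewrite /in_order w1 w0 val_m0 val_m1.
rewrite big_mkcondr sum_lift_perm -big_mkcond /= [in RHS]scaler_sumr.
apply: eq_big => [s|s].
  by rewrite lift_perm_lift (inj_eq (@lift_inj _ _)).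
rewrite lift_perm_lift => /eqP/lift_inj sl.
rewrite (coface_inner def_i) def_i -val_m1.
by have := twist_lift_perm s l1 m1 l1; rewrite ppermE sl -/m1.
Qed.

(** The cyclic rotation of the positions turns the first coface into the last
one. It matches the orderings in which l0 is not first with those in which l1 is
not last, and the remaining ones give the two terms on the right. *)
Lemma ordered_sum_ends :
  ordered_sum (coface E ord0) + (-1) ^+ n.+1 *: ordered_sum (coface E ord_max) =
  (-1) ^+ l *: (full_sum (hat E n l) + full_sum (hat E n l.+1)).
Proof.
rewrite hat_l0 hat_l1; pose c : 'S_n.+1 := lift_perm ord0 ord_max 1%g.
have cE (k : 'I_n.+1) : c k = (if k == 0 :> nat then n else k.-1) :> nat.
  case: (unliftP ord0 k) => [[j lt_j] ->|->];
    rewrite ?lift_perm_id // lift_perm_lift.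
  by rewrite perm1 /= /bump /=; have : (j < n)%N := lt_j; lia.
have odd_c : (-1) ^+ c = (-1) ^+ n :> F.
  by rewrite odd_lift_perm odd_perm1 addbF signr_odd.
rewrite /ordered_sum (bigID (fun w : 'S_n.+1 => w l0 == ord0)) /=.
rewrite [in X in _ + X](bigID (fun w : 'S_n.+1 => w l1 == ord_max)) /=.
have -> : \sum_(w | in_order w && (w l0 != ord0)) twist w (coface E ord0) =
    (-1) ^+ n *: \sum_(w | in_order w && (w l1 != ord_max))
                    twist w (coface E ord_max).
  rewrite [in RHS](reindex_inj (mulIg c)) /= scaler_sumr; apply: eq_big => w.
    rewrite /in_order !permM -!val_eqE /= !cE.
    by have := ltn_ord (w l1); do ?[case: eqP => ?]; lia.
  move=> _; rewrite /twist odd_permM signr_addb odd_c actM coface_last_first.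
  by rewrite -/c !ccompA scalerA mulrCA -expr2 sqrr_sign mulr1.
rewrite scalerDr [X in _ + X = _]addrC exprS mulN1r scaleNr addrA addrK.
rewrite (eq_bigl (fun w : 'S_n.+1 => w l0 == ord0)); last first.
  move=> w; apply: andb_idl => /eqP w0; rewrite /in_order w0 lt0n.
  apply/eqP => w1; have /perm_inj/(congr1 (@nat_of_ord _)): w l0 = w l1.
    by rewrite w0; apply: val_inj.
  by rewrite val_l0 /= /bump /=; lia.
rewrite (eq_bigl (fun w : 'S_n.+1 => w l1 == ord_max)
  (fun w => twist w (coface E ord_max))); last first.
  move=> w; apply: andb_idl => /eqP w1; rewrite /in_order w1 /= ltn_neqAle.
  rewrite -ltnS ltn_ord andbT; apply/eqP => w0.
  have /perm_inj/(congr1 (@nat_of_ord _)): w l0 = w l1.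
    by rewrite w1; apply: val_inj.
  by rewrite val_l0 /= /bump /=; lia.
rewrite coface_first coface_last !sum_twist_lift_perm0 scalerDr.
rewrite expr0 mulr1 val_l0.
congr (_ + _); rewrite scalerA; congr (_ *: _).
have -> : (-1) ^+ l1 = - (-1) ^+ l :> F by rewrite /= /bump /= exprS mulN1r.
by rewrite !mulNr mulrN opprK mulrCA -expr2 sqrr_sign mulr1.
Qed.

Lemma ordered_sum_differential :
  ordered_sum (differential E n) =
  (-1) ^+ l *: (full_sum (hat E n l) + full_sum (hat E n l.+1)
                - full_sum (emap E (collapse l1 l1))).
Proof.
have lin (G : 'I_n.+2 -> mor (E n) (E n.+1)) :
    ordered_sum (\sum_(i < n.+2) (-1) ^+ i *: G i) =
    \sum_(i < n.+2) (-1) ^+ i *: ordered_sum (G i).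
  rewrite /ordered_sum.
  rewrite (eq_bigr (fun w => \sum_(i < n.+2) (-1) ^+ i *: twist w (G i))).
    by rewrite exchange_big; apply: eq_bigr => i _; rewrite scaler_sumr.
  move=> w _; rewrite /twist ccomp_suml ccomp_sumr scaler_sumr.
  by apply: eq_bigr => i _; rewrite ccompZl ccompZr !scalerA mulrC.
rewrite lin sum_cofaces expr0 scale1r addrAC ordered_sum_ends [in RHS]scalerDr.
congr (_ + _); rewrite scalerN -scaleNr.
rewrite /full_sum (partition_big (fun s : 'S_n => s l) xpredT) //= scaler_sumr.
apply: eq_bigr => m _; rewrite (@ordered_sum_inner m) // scalerA.
congr (_ *: _).
rewrite mulrCA -expr2 sqrr_sign mulr1 /= /bump /=.
by rewrite exprS mulN1r.
Qed.

(** Summed over the orderings in which l0 precedes l1, the equation dz = 0 is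
the additivity of the antisymmetrisation of z in one variable. *)
Lemma alt_cocycle_additive : differential E n <o> z = 0 ->
  emap E (collapse l1 l1) <o> (antisymmetriser E n <o> z) =
  hat E n l <o> (antisymmetriser E n <o> z)
  + hat E n l.+1 <o> (antisymmetriser E n <o> z).
Proof.
move=> dz0.
have alt_full c :
    c <o> (antisymmetriser E n <o> z) = (n`!%:R)^-1 *: full_sum c.
  rewrite /antisymmetriser ccompZl ccompZr; congr (_ *: _).
  rewrite ccomp_suml ccomp_sumr; apply: eq_bigr => s _.
  by rewrite ccompZl ccompZr.
rewrite !alt_full -scalerDr; congr (_ *: _).
apply/esym/eqP; rewrite -subr_eq0.
have := ordered_sum_differential.
rewrite /ordered_sum /twist dz0 big1 => [|w _]; last first.
  by rewrite ccomp0r scaler0.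
by move/esym/eqP; rewrite scaler_eq0 signr_eq0.
Qed.

End AltCocycle.
End Cosimplicial.

(** * Poly-primitive elements and the top Hodge component *)

Section TopHodge.
Variables (F : fieldType) (V : sym_tensor_category F).
Variable E : sym_cosimplicial_monoid V.
Hypothesis charF : [pchar F] =i pred0.

Lemma polyprimitive_collapse n (X : V) (a : mor X (E n)) (l : 'I_n) :
  polyprimitive a ->
  emap E (collapse (lift ord0 l) (lift ord0 l)) <o> a =
  emap E (collapse (lift (lift ord0 l) l) ord0) <o> a
  + emap E (collapse (lift ord0 l) ord0) <o> a.
Proof.
pose i := widen_ord (leqnSn n.+1) (lift ord0 l); move=> /(_ i) prim_a.
have lt_i : (0 < i < n.+1)%N by have := ltn_ord l; rewrite /= /bump /=; lia.
rewrite -(@coface_inner _ _ _ _ _ i) // (prim_a lt_i).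
have def_l : lift (lift ord0 l) l = l :> nat by rewrite /= /bump /=; lia.
by rewrite -!hatE def_l.
Qed.

Lemma alt_cocycle_polyprimitive n (X : V) (z : mor X (E n)) :
  differential E n <o> z = 0 -> polyprimitive (antisymmetriser E n <o> z).
Proof.
move=> dz0 i' /andP[i_gt0 lt_i]; pose i := i'.-1.
have lt_in : (i < n)%N by rewrite /i; lia.
have def_i : i' = (Ordinal lt_in).+1 :> nat by rewrite /= /i prednK.
by rewrite (coface_inner E def_i) alt_cocycle_additive // def_i.
Qed.

Lemma alt_cocycle_antisymmetric n (X : V) (z : mor X (E n)) :
  antisymmetric_elt (antisymmetriser E n <o> z).
Proof. by move=> i lt_i; rewrite ccompA alt_antisymmetric // ccompNl. Qed.

(** The antisymmetriser kills coboundaries, so it descends to a map from the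
cohomology to E(n). This map is anti-symmetric and poly-primitive since it is so
on cocycles, hence it factors through P; the factor pi is the projection onto
the summand. *)
Lemma primitive_part_top_hodge (n : nat) (Z H P : V)
    (i : mor Z (E n)) (q : mor Z H) (p : mor P (E n)) :
  is_cohomology i q -> is_primitive_part p ->
  exists p' : mor P Z, i <o> p' = p /\ is_top_hodge i q (q <o> p').
Proof.
move=> [ker_i [u [def_u coker_q]]] [anti_p prim_p univ_p].
have [di0 univ_i] := ker_i; have [qu0 univ_q] := coker_q.
have [p' [ip' _]] := univ_i P p (polyprimitive_cocycle prim_p).
exists p'; split=> //.
have alt_i_anti := alt_cocycle_antisymmetric i.
have alt_i_prim := alt_cocycle_polyprimitive di0.
have [eZ [i_eZ _]] := univ_i Z _ (polyprimitive_cocycle alt_i_prim).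
have alt_iu0 : (antisymmetriser E n <o> i) <o> u = 0.
  by rewrite -ccompA def_u alt_differential_in.
have [h [hq _]] := univ_q _ _ alt_iu0.
have h_anti : antisymmetric_elt h.
  move=> t lt_t; apply: (cokernel_epi coker_q).
  by rewrite -ccompA hq ccompNl hq alt_i_anti.
have h_prim : polyprimitive h.
  move=> t lt_t; apply: (cokernel_epi coker_q).
  by rewrite ccompDl -!ccompA hq alt_i_prim.
have [pi [p_pi _]] := univ_p _ _ h_anti h_prim.
have p_mono (T : V) (f g : mor T P) : p <o> f = p <o> g -> f = g.
  move=> eq_fg; have [||k [_ uniq_k]] := univ_p T (p <o> g).
  - by move=> t lt_t; rewrite ccompA anti_p // ccompNl.
  - by move=> t lt_t; rewrite !ccompA prim_p // ccompDl.
  by rewrite -(uniq_k f) // (uniq_k g).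
have eZE : p' <o> pi <o> q = eZ.
  apply: (kernel_mono ker_i).
  by rewrite !ccompA ip' p_pi hq i_eZ.
exists eZ, (q <o> p' <o> pi); split.
- by [].
- by rewrite -eZE !ccompA.
exists pi; split=> //; apply: p_mono.
by rewrite ccomp_idr !ccompA p_pi hq -ccompA ip' alt_id.
Qed.

End TopHodge.

(** * Expansion of poly-primitive elements *)

Section Expansion.
Variables (F : fieldType) (V : sym_tensor_category F).
Variable E : sym_cosimplicial_monoid V.
Hypothesis charF : [pchar F] =i pred0.

Definition kill r p (f : ptmap r p) (K : pred 'I_r.+1) : ptmap r p :=
  pointed (fun x => if K x then ord0 else f x).

Lemma killE r p (f : ptmap r p) K x : kill f K x = if K x then ord0 else f x.
Proof. by rewrite ffunE; case: eqP => // ->; rewrite ptmap0 if_same. Qed.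

(** Additivity in the l-th variable, for an element in which a sum of several
variables has been substituted for it: the sum is split into the part inside S
and the part outside S. *)
Lemma polyprimitive_split r p (X : V) (a : mor X (E p)) (f : ptmap r p)
    (l : 'I_p) (S : pred 'I_r.+1) :
  polyprimitive a ->
  emap E f <o> a =
  emap E (kill f (fun x => (f x == lift ord0 l) && S x)) <o> a
  + emap E (kill f (fun x => (f x == lift ord0 l) && ~~ S x)) <o> a.
Proof.
move=> prim_a; pose l1 : 'I_p.+1 := lift ord0 l; pose l0 : 'I_p.+1 := lift l1 l.
have val_l0 : l0 = l :> nat by rewrite /= /bump /=; lia.
(* The variables over l are redistributed between l1, if they belong to S, and
   l0 otherwise, the other values being shifted to make room. *)
pose g : ptmap r p.+1 := pointed (fun x =>
  if f x == l1 then (if S x then lift ord0 l1 else lift ord0 l0)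
  else if unlift ord0 (f x) is Some y then lift ord0 (lift l1 y) else ord0).
have gE x : g x =
  if f x == l1 then (if S x then lift ord0 l1 else lift ord0 l0)
  else if unlift ord0 (f x) is Some y then lift ord0 (lift l1 y) else ord0.
  rewrite ffunE; case: (eqVneq x ord0) => // ->; rewrite ptmap0 unlift_none.
  by rewrite (negPf (neq_lift _ _)).
have l1E : l1 = lift l0 l by apply: val_inj; rewrite /= /bump /=; lia.
have merge_g : f = ptmap_comp (collapse l1 l1) g.
  apply: ptmapP => x; rewrite ptmap_compE gE; case: eqP => [->|_].
    by case: (S x); rewrite ?collapse_id ?collapse_lift.
  by case: unliftP => [y ->|->]; rewrite ?collapse_lift ?ptmap0.
have drop_l1 : kill f (fun x => (f x == l1) && S x) =
    ptmap_comp (collapse l1 ord0) g.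
  apply: ptmapP => x; rewrite ptmap_compE gE killE; case: eqP => [->|_].
    by case: (S x); rewrite ?collapse_id ?collapse_lift.
  by case: unliftP => [y ->|->]; rewrite ?collapse_lift ?ptmap0.
have drop_l0 : kill f (fun x => (f x == l1) && ~~ S x) =
    ptmap_comp (collapse l0 ord0) g.
  apply: ptmapP => x; rewrite ptmap_compE gE killE; case: eqP => [->|ne_x].
    by case: (S x); rewrite /= ?collapse_id // l1E collapse_lift -l1E.
  case: unliftP => [[y lt_y] fx|->]; last by rewrite ptmap0.
  have -> : lift l1 (Ordinal lt_y) = lift l0 (Ordinal lt_y).
    have ne_y : y <> l :> nat.
      by move=> eq_y; apply: ne_x; rewrite fx; apply: val_inj; rewrite /= eq_y.
    by apply: val_inj; rewrite /= /bump /=; lia.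
  by rewrite collapse_lift fx.
rewrite drop_l1 drop_l0 [in LHS]merge_g !emap_comp -!ccompA.
by rewrite polyprimitive_collapse // ccompDr addrC.
Qed.

Definition reads_once r p (f : ptmap r p) : Prop :=
  forall l : 'I_p, #|[pred x | f x == lift ord0 l]| = 1%N.

(** Additivity expands E(f)(a) as a sum of terms in which each variable of a is
replaced by a single variable: if two variables are substituted for the same one
the sum can be split, and if none is then E(f)(a) = 2 E(f)(a) vanishes. *)
Lemma polyprimitive_ind r p (X : V) (a : mor X (E p))
    (good : mor X (E r) -> Prop) :
  polyprimitive a -> good 0 ->
  (forall u v, good u -> good v -> good (u + v)) ->
  (forall h : ptmap r p, reads_once h -> good (emap E h <o> a)) ->
  forall f : ptmap r p, good (emap E f <o> a).
Proof.
move=> prim_a good0 goodD good_once f.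
have [m] := ubnP #|[pred x | f x != ord0]|; elim: m f => // m IHm f le_m.
have [/forallP once|] :=
  boolP [forall l : 'I_p, #|[pred x | f x == lift ord0 l]| == 1%N].
  by apply: good_once => l; apply/eqP.
rewrite negb_forall => /existsP[l].
set fib := [pred x | f x == lift ord0 l] => not_once.
case: (pickP fib) => [v fib_v|fib0]; last first.
  (* Nothing lies over l, so killing the fibre does not change f. *)
  have := polyprimitive_split f l xpred0 prim_a.
  set f1 := kill f _; set f2 := kill f _.
  have -> : f1 = f.
    by apply: ptmapP => x; rewrite killE /= andbF.
  have -> : f2 = f.
    by apply: ptmapP => x; rewrite killE /= -[f x == _]/(fib x) fib0.
  by rewrite -[LHS]addr0 => /addrI <-.
have smaller (K : pred 'I_r.+1) x :
    fib x -> K x -> (#|[pred y | kill f K y != ord0%R]| < m)%N.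
  move=> fib_x Kx; rewrite -ltnS; apply: leq_trans le_m; rewrite ltnS.
  apply: proper_card; apply/properP; split.
    by apply/subsetP => y; rewrite !inE killE; case: (K y); rewrite ?eqxx.
  by exists x; rewrite !inE ?killE ?Kx ?eqxx // (eqP fib_x).
have [w /andP[fib_w ne_wv]|only_v] := pickP [pred x | fib x && (x != v)].
  rewrite (polyprimitive_split f l (pred1 v) prim_a).
  by apply: goodD; apply: IHm;
    [apply: (smaller _ v) | apply: (smaller _ w)] => //=;
    rewrite -[f _ == _]/(fib _) ?fib_v ?fib_w /= ?eqxx.
case/eqP: not_once; rewrite -(card1 v); apply: eq_card => x.
have := only_v x; rewrite !inE /=.
have [->|_] := eqVneq x v; last by rewrite andbT.
by move: fib_v => /= ->.
Qed.

(** The exchange of two variables that are read by a exchanges two variables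
of a. *)
Lemma act_once_antisymmetric r p (X : V) (a : mor X (E p)) (f : ptmap r p)
    (u v : 'I_r) :
  antisymmetric_elt a -> reads_once f -> u != v ->
  f (lift ord0 u) != ord0 -> f (lift ord0 v) != ord0 ->
  emap E (pperm (tperm u v)) <o> (emap E f <o> a) = - (emap E f <o> a).
Proof.
move=> anti_a once_f ne_uv.
case: (unliftP ord0 (f (lift ord0 u))) => [i fu _|->]; last by rewrite eqxx.
case: (unliftP ord0 (f (lift ord0 v))) => [j fv _|->]; last by rewrite eqxx.
have once x y k : f x = lift ord0 k -> f y = lift ord0 k -> x = y.
  move=> fx fy; have /eqP/card1P[w fw] := once_f k.
  have := fw x; have := fw y; rewrite !inE fx fy eqxx.
  by move=> /esym/eqP-> /esym/eqP->.
have ne_ij : i != j.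
  apply: contraNneq ne_uv => eq_ij.
  apply/eqP/(@lift_inj _ ord0)/(once _ _ i fu).
  by rewrite fv eq_ij.
rewrite ccompA -emap_comp.
have -> : ptmap_comp f (pperm (tperm u v)) = ptmap_comp (pperm (tperm i j)) f.
  apply: ptmap_nzP => x; rewrite !ptmap_compE ppermE.
  case: tpermP => [->|->|ne_xu ne_xv]; first by rewrite fu fv ppermE tpermL.
    by rewrite fu fv ppermE tpermR.
  case: (unliftP ord0 (f (lift ord0 x))) => [k fx|->]; last by rewrite ptmap0.
  rewrite fx ppermE tpermD //; apply/eqP => eq_k; rewrite -eq_k in fx.
    by apply: ne_xu; apply: (@lift_inj _ ord0); apply: once fx fu.
  by apply: ne_xv; apply: (@lift_inj _ ord0); apply: once fx fv.
rewrite emap_comp -ccompA antisymmetric_act // odd_tperm ne_ij.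
by rewrite expr1 scaleN1r ccompNr.
Qed.

(** Two sets of p and q variables among r < p + q - 1 have at least two elements
in common. *)
Lemma reads_once_common r p q (f : ptmap r p) (g : ptmap r q) :
  reads_once f -> reads_once g -> (r.+2 <= p + q)%N ->
  exists u v : 'I_r,
    [/\ u != v, f (lift ord0 u) != ord0, f (lift ord0 v) != ord0 &
        g (lift ord0 u) != ord0 /\ g (lift ord0 v) != ord0].
Proof.
pose read n (h : ptmap r n) := [set x : 'I_r | h (lift ord0 x) != ord0].
have card_read n (h : ptmap r n) : reads_once h -> (n <= #|read n h|)%N.
  move=> once_h.
  have [pre preP] : exists pre : 'I_n -> 'I_r,
      forall l, h (lift ord0 (pre l)) = lift ord0 l.
    apply: (@fin_all_exists _ (fun=> 'I_r)
      (fun l x => h (lift ord0 x) = lift ord0 l)) => l.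
    have /eqP/card1P[w hw] := once_h l.
    have := hw w; rewrite !inE eqxx => /eqP.
    by case: (unliftP ord0 w) => [x -> |->]; [exists x | rewrite ptmap0].
  have inj_pre : injective pre.
    by move=> l l' eq_pre; apply: (@lift_inj _ ord0); rewrite -!preP eq_pre.
  rewrite -[X in (X <= _)%N]card_ord -(card_imset _ inj_pre) subset_leq_card //.
  by apply/subsetP => _ /imsetP[l _ ->]; rewrite inE preP.
move=> /card_read ge_p /card_read ge_q le_r.
have : (1 < #|read p f :&: read q g|)%N.
  have := cardsUI (read p f) (read q g).
  have := max_card (read p f :|: read q g); rewrite card_ord; lia.
case/card_gt1P => u [v [/setIP[fu gu] /setIP[fv gv] ne_uv]].
by exists u, v; rewrite !inE in fu gu fv gv; split.
Qed.

(** After expansion, the two factors have two variables in common, and the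
exchange of these fixes the product but changes the sign of the
antisymmetriser. *)
Lemma alt_product_zero r p q (X Y : V) (a : mor X (E p)) (b : mor Y (E q))
    (f : ptmap r p) (g : ptmap r q) :
  antisymmetric_elt a -> polyprimitive a ->
  antisymmetric_elt b -> polyprimitive b -> (r.+2 <= p + q)%N ->
  antisymmetriser E r <o>
    (mmul (E r) <o> ((emap E f <o> a) <xm> (emap E g <o> b))) = 0.
Proof.
move=> anti_a prim_a anti_b prim_b le_r.
pattern (emap E f <o> a); apply: polyprimitive_ind f => //.
- by rewrite tensm0l !ccomp0r.
- by move=> x y x0 y0; rewrite tensmDl !ccompDr x0 y0 addr0.
move=> f once_f.
pattern (emap E g <o> b); apply: polyprimitive_ind g => //.
- by rewrite tensm0r !ccomp0r.
- by move=> x y x0 y0; rewrite tensmDr !ccompDr x0 y0 addr0.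
move=> g once_g.
have [u [v [ne_uv fu fv [gu gv]]]] := reads_once_common once_f once_g le_r.
pose t := pperm (tperm u v); set x := emap E f <o> a; set y := emap E g <o> b.
have tx : emap E t <o> x = - x by apply: act_once_antisymmetric.
have ty : emap E t <o> y = - y by apply: act_once_antisymmetric.
have fixed :
    emap E t <o> (mmul (E r) <o> (x <xm> y)) = mmul (E r) <o> (x <xm> y).
  have [morph_t _] := emap_morphism E t.
  by rewrite ccompA morph_t -ccompA -tensm_comp tx ty tensmNN.
apply: (eq_opp0 charF); rewrite -{1}fixed ccompA alt_actr odd_tperm ne_uv.
by rewrite expr1 scaleN1r ccompNl.
Qed.

End Expansion.

(** * The bracket *)

(** A path of length p + q + 2 has only p + q + 1 inner points to turn at. *)
Lemma no_path p q k (w : (p + q).+2.-tuple bool) :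
  (p + q < k)%N -> is_path p q k w = false.
Proof.
move=> lt_k; apply/negP => /and4P[_ _ /eqP].
rewrite size_tuple /= => corners _.
have := count_size (corner w) (iota 1 (p + q).+1).
by rewrite size_iota; move: corners; rewrite /corner /=; lia.
Qed.

Theorem theorem2p72 (F : fieldType) (charF : [pchar F] =i pred0)
    (V : sym_tensor_category F) (E : sym_cosimplicial_monoid V) :
  (forall (n : nat) (Z H P : V)
      (i : mor Z (E n)) (q : mor Z H) (p : mor P (E n)),
    is_cohomology i q -> is_primitive_part p ->
    exists p' : mor P Z, i <o> p' = p /\ is_top_hodge i q (q <o> p'))
  /\
  (forall k : nat, (2 <= k)%N -> k_commutative E k ->
    forall (m n : nat) (Pm Pn : V) (pm : mor Pm (E m)) (pn : mor Pn (E n)),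
      is_primitive_part pm -> is_primitive_part pn ->
      antisymmetriser E (m + n - k)%N <o> (bracket E k m n <o> (pm <xm> pn)) = 0).
Proof.
split; first exact: primitive_part_top_hodge.
move=> k ge2k _ m n Pm Pn pm pn [anti_m prim_m _] [anti_n prim_n _].
rewrite /bracket ccomp_suml ccomp_sumr big1 // => w path_w.
have le_k : (k <= m + n)%N.
  by rewrite leqNgt; apply: contraL path_w => /no_path->.
rewrite ccompZl ccompZr /path_op /cosimp; case: (head true w).
  by rewrite -ccompA -tensm_comp alt_product_zero ?scaler0 //; lia.
rewrite -!ccompA braid_nat (ccompA (_ <xm> _)) -tensm_comp.
rewrite (ccompA (mmul _)) ccompA alt_product_zero ?ccomp0l ?scaler0 //.
by lia.
Qed.
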